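(* Let $\Gamma;s$ be an extended context and $t,t',u$ terms. If $\Gamma;s\vdash t\leq^*_{\mathrm{wf}}u$ and $t\mapsto t'$, then $\Gamma;s\vdash t'\leq^*_{\mathrm{wf}}u$.
   Context: Terms: $t ::= x \mid \top \mid (\lambda x\leq t.u) \mid (u\,v)$, with $x$ from a countably infinite set of variables and $\top$ a constant; $x$ is bound in $u$ in $\lambda x\leq t.u$; terms identified up to renaming of bound variables; $\mathrm{fv}$ = free variables, $u[x:=v]$ = capture-avoiding substitution. $\mapsto$ is the least relation with $(\lambda x\leq t.u)\,v\mapsto u[x:=v]$ closed under all term contexts (if $t\mapsto t'$ then $\lambda x\leq t.u\mapsto\lambda x\leq t'.u$, $\lambda x\leq u.t\mapsto\lambda x\leq u.t'$, $t\,u\mapsto t'\,u$, $u\,t\mapsto u\,t'$). Extended context $\Gamma;s$: a finite sequence $\Gamma$ of annotations $x\leq t$ and a finite list (stack) $s$ of terms; $\varepsilon;[]$ empty, $\Gamma,x\leq t;s$ appends an annotation, $\Gamma;\alpha::s$ pushes $\alpha$. $\mathrm{dom}(\Gamma)$ = annotated variables; $x\leq t\in\Gamma$ means the annotation occurs in $\Gamma$; ''$x$ has subtype $t$ in $\Gamma$'' means $x\leq t$ is the last annotation for $x$ in $\Gamma$. Prevalidity: least predicate with $\varepsilon;[]$ prevalid; $\Gamma,x\leq t;[]$ prevalid if $\Gamma;[]$ prevalid, $x\notin\mathrm{dom}(\Gamma)$, $\mathrm{fv}(t)\subseteq\mathrm{dom}(\Gamma)$; $\Gamma;\alpha::s$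 prevalid if $\Gamma;s$ prevalid and $\mathrm{fv}(\alpha)\subseteq\mathrm{dom}(\Gamma)$. Equivalence reduction $\to_{\equiv}$: least relation with $x\to_{\equiv}x$; $\top\to_{\equiv}\top$; $\top\,u\to_{\equiv}\top$; if $u\to_{\equiv}u'$, $v\to_{\equiv}v'$ then $u\,v\to_{\equiv}u'\,v'$ and $(\lambda x\leq t.u)\,v\to_{\equiv}u'[x:=v']$; if $t\to_{\equiv}t'$, $u\to_{\equiv}u'$ then $\lambda x\leq t.u\to_{\equiv}\lambda x\leq t'.u'$. Subtyping reduction $\Gamma;s\vdash u\to_{\leq}v$: least relation with (Prom) $\Gamma;s$ prevalid and $x\leq t\in\Gamma$ give $\Gamma;s\vdash x\to_{\leq}t$; (Top) $\Gamma;s$ prevalid gives $\Gamma;s\vdash u\to_{\leq}\top$; (Eq) $\Gamma;s$ prevalid and $u\to_{\equiv}v$ give $\Gamma;s\vdash u\to_{\leq}v$; (App) $\Gamma;v::s\vdash u\to_{\leq}u'$ gives $\Gamma;s\vdash u\,v\to_{\leq}u'\,v$; (FunOp) $\Gamma,x\leq\alpha;s\vdash u\to_{\leq}u'$ gives $\Gamma;\alpha::s\vdash\lambda x\leq t.u\to_{\leq}\lambda x\leq t.u'$; (Fun) $\Gamma,x\leq t;[]\vdash u\to_{\leq}u'$ gives $\Gamma;[]\vdash\lambda x\leq t.u\to_{\leq}\lambda x\leq t.u'$. Subtyping: $\Gamma;s\vdash v\leq t$ is the least relation with: if $\Gamma;s$ prevalid then $\Gamma;s\vdash t\leq t$; if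 $\Gamma;s\vdash v\to_{\leq}v'$ and $\Gamma;s\vdash v'\leq t$ then $\Gamma;s\vdash v\leq t$; if $\Gamma;s\vdash v\leq t'$ and $t\to_{\equiv}t'$ then $\Gamma;s\vdash v\leq t$. Well-formedness $\Gamma;s\vdash t\ \mathrm{wf}$, well-subtyping $\leq_{\mathrm{wf}}$ and transitive well-subtyping $\leq^*_{\mathrm{wf}}$ are the least relations (defined simultaneously) with: (W-Var) if $\Gamma;s$ prevalid, $x$ has subtype $t$ in $\Gamma$ and $\Gamma;s\vdash t\ \mathrm{wf}$ then $\Gamma;s\vdash x\ \mathrm{wf}$; (W-Top) if $\Gamma;s$ prevalid then $\Gamma;s\vdash\top\ \mathrm{wf}$; (W-Fun) if $\Gamma,x\leq t;[]\vdash u\ \mathrm{wf}$ and $\Gamma;[]\vdash t\ \mathrm{wf}$ then $\Gamma;[]\vdash\lambda x\leq t.u\ \mathrm{wf}$; (W-FunOp) if $\Gamma,x\leq\delta;s\vdash u\ \mathrm{wf}$ and $\Gamma;[]\vdash t\ \mathrm{wf}$ then $\Gamma;\delta::s\vdash\lambda x\leq t.u\ \mathrm{wf}$; (W-App) if $\Gamma;v::s\vdash u\leq^*_{\mathrm{wf}}\lambda x\leq t.\top$ and $\Gamma;[]\vdash v\leq^*_{\mathrm{wf}}t$ then $\Gamma;s\vdash u\,v\ \mathrm{wf}$; (Wf-Rule) if $\Gamma;s\vdash u\ \mathrm{wf}$, $\Gamma;s\vdash t\ \mathrm{wf}$ and $\Gamma;s\vdash u\leq t$ then $\Gamma;s\vdash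 u\leq_{\mathrm{wf}}t$; (Wf-Sub) $\Gamma;s\vdash v\leq_{\mathrm{wf}}t$ gives $\Gamma;s\vdash v\leq^*_{\mathrm{wf}}t$; (Wf-Trans) if $\Gamma;s\vdash v\leq^*_{\mathrm{wf}}u$, $\Gamma;s\vdash u\leq^*_{\mathrm{wf}}t$ and $\Gamma;s\vdash u\ \mathrm{wf}$ then $\Gamma;s\vdash v\leq^*_{\mathrm{wf}}t$. *)

(* Defs.v *)
From mathcomp Require Import all_boot.

Set Implicit Arguments.
Unset Strict Implicit.
Unset Printing Implicit Defensive.

(* Terms over a type V of variables. In Lam t u (the term \x <= t. u) the bound
   variable of u is None and a variable y of the enclosing scope is Some y, so
   that Leibniz equality is equality up to renaming of bound variables. *)
Inductive term (V : Type) : Type :=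
| Var of V
| Top
| Lam of term V & term (option V)
| App of term V & term V.

Arguments Top {V}.

Fixpoint rename (V W : Type) (f : V -> W) (t : term V) {struct t} : term W :=
  match t with
  | Var x => Var (f x)
  | Top => Top
  | Lam a u => Lam (rename f a) (rename (omap f) u)
  | App u v => App (rename f u) (rename f v)
  end.

Definition lift_subst (V W : Type) (f : V -> term W) (o : option V) :
    term (option W) :=
  if o is Some y then rename Some (f y) else Var None.

Fixpoint bind (V W : Type) (f : V -> term W) (t : term V) {struct t} : term W :=
  match t with
  | Var x => f x
  | Top => Top
  | Lam a u => Lam (bind f a) (bind (lift_subst f) u)
  | App u v => App (bind f u) (bind f v)
  end.

(* In the Lam case, pmap id removes the bound variable None. *)
Fixpoint fv (V : Type) (t : term V) {struct t} : seq V :=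
  match t with
  | Var x => [:: x]
  | Top => [::]
  | Lam a u => fv a ++ pmap id (fv u)
  | App u v => fv u ++ fv v
  end.

Notation tm := (term nat).

(* The term \x <= t. u for a named variable x: x is bound in u but not in t. *)
Definition lam (x : nat) (t u : tm) : tm :=
  Lam t (rename (fun y => if y == x then None else Some y) u).

(* u[x := v] *)
Definition subst (x : nat) (v u : tm) : tm :=
  bind (fun y => if y == x then v else Var y) u.

Inductive red : tm -> tm -> Prop :=
| red_beta x t u v : red (App (lam x t u) v) (subst x v u)
| red_body x t u u' : red u u' -> red (lam x t u) (lam x t u')
| red_annot x t t' u : red t t' -> red (lam x t u) (lam x t' u)
| red_fun u u' v : red u u' -> red (App u v) (App u' v)
| red_arg u v v' : red v v' -> red (App u v) (App u v').

(* The head of the list is the most recent (i.e. last) annotation: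
   (x, t) :: G is the context G extended with x <= t. *)
Definition ctx := seq (nat * tm).
Definition stack := seq tm.

Definition dom (G : ctx) : seq nat := unzip1 G.

Definition annotated (G : ctx) (x : nat) (t : tm) : Prop :=
  exists G1 G2 : ctx, G = G1 ++ (x, t) :: G2.

Definition has_subtype (G : ctx) (x : nat) (t : tm) : Prop :=
  exists G1 G2 : ctx, G = G1 ++ (x, t) :: G2 /\ x \notin dom G1.

Inductive prevalid : ctx -> stack -> Prop :=
| prevalid_nil : prevalid [::] [::]
| prevalid_annot G x t :
    prevalid G [::] -> x \notin dom G -> {subset fv t <= dom G} ->
    prevalid ((x, t) :: G) [::]
| prevalid_push G a s :
    prevalid G s -> {subset fv a <= dom G} -> prevalid G (a :: s).

Inductive eqred : tm -> tm -> Prop :=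
| eqred_var x : eqred (Var x) (Var x)
| eqred_top : eqred Top Top
| eqred_topapp u : eqred (App Top u) Top
| eqred_app u u' v v' :
    eqred u u' -> eqred v v' -> eqred (App u v) (App u' v')
| eqred_beta x t u u' v v' :
    eqred u u' -> eqred v v' ->
    eqred (App (lam x t u) v) (subst x v' u')
| eqred_lam x t t' u u' :
    eqred t t' -> eqred u u' -> eqred (lam x t u) (lam x t' u').

Inductive subred : ctx -> stack -> tm -> tm -> Prop :=
| subred_prom G s x t :
    prevalid G s -> annotated G x t -> subred G s (Var x) t
| subred_top G s u : prevalid G s -> subred G s u Top
| subred_eq G s u v : prevalid G s -> eqred u v -> subred G s u v
| subred_app G s u u' v :
    subred G (v :: s) u u' -> subred G s (App u v) (App u' v)
| subred_funop G s x a t u u' :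
    subred ((x, a) :: G) s u u' ->
    subred G (a :: s) (lam x t u) (lam x t u')
| subred_fun G x t u u' :
    subred ((x, t) :: G) [::] u u' ->
    subred G [::] (lam x t u) (lam x t u').

Inductive sub (G : ctx) (s : stack) : tm -> tm -> Prop :=
| sub_refl t : prevalid G s -> sub G s t t
| sub_left v v' t : subred G s v v' -> sub G s v' t -> sub G s v t
| sub_right v t t' : sub G s v t' -> eqred t t' -> sub G s v t.

Inductive wf : ctx -> stack -> tm -> Prop :=
| wf_var G s x t :
    prevalid G s -> has_subtype G x t -> wf G s t -> wf G s (Var x)
| wf_top G s : prevalid G s -> wf G s Top
| wf_fun G x t u :
    wf ((x, t) :: G) [::] u -> wf G [::] t -> wf G [::] (lam x t u)
| wf_funop G s x d t u :
    wf ((x, d) :: G) s u -> wf G [::] t -> wf G (d :: s) (lam x t u)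
| wf_app G s x t u v :
    wfsub_trans G (v :: s) u (lam x t Top) -> wfsub_trans G [::] v t ->
    wf G s (App u v)
with wfsub : ctx -> stack -> tm -> tm -> Prop :=
| wfsub_rule G s u t : wf G s u -> wf G s t -> sub G s u t -> wfsub G s u t
with wfsub_trans : ctx -> stack -> tm -> tm -> Prop :=
| wfsub_trans_sub G s v t : wfsub G s v t -> wfsub_trans G s v t
| wfsub_trans_trans G s v u t :
    wfsub_trans G s v u -> wfsub_trans G s u t -> wf G s u ->
    wfsub_trans G s v t.

(* Main.v *)
Require Import Defs.
From mathcomp Require Import all_boot.
From Stdlib Require List.

Set Implicit Arguments.
Unset Strict Implicit.
Unset Printing Implicit Defensive.

(* It suffices that well-formedness is preserved: if t reduces to t', then
   t' <= t holds at once, since the right-hand side of a subtyping may be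
   expanded, and t' can be prepended to the chain from t to u.

   Well-formedness is preserved by parallel reduction of the context, the stack
   and the term simultaneously, which makes the induction hypotheses usable when
   an argument that was pushed on the stack, or became an annotation, is reduced.
   The subtypings in a derivation survive because parallel reduction has the
   diamond property and commutes with subtyping reduction. In the case of a redex
   the operational rule for abstractions annotates the bound variable with the
   argument itself, so the substitution lemma only has to replace a variable by
   its own annotation: a promotion x <= v becomes v <= v. *)

Notation In := List.In.

(** * Renaming, substitution and free variables *)

Lemma In_mem (T : eqType) (x : T) (l : seq T) : reflect (In x l) (x \in l).
Proof.
elim: l => [|y l IH] /=; first exact: ReflectF.
rewrite inE; apply: (iffP orP) => [[/eqP->|/IH]|[->|/IH]]; by [left|right].
Qed.

Lemma In_pmap_id (V : Type) (x : V) (l : seq (option V)) :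
  In x (pmap id l) <-> In (Some x) l.
Proof.
elim: l => [|[y|] l [IH1 IH2]] //=; split.
- by case=> [->|/IH1]; [left|right].
- by case=> [[->]|/IH2]; [left|right].
- by move/IH1; right.
- by case=> // /IH2.
Qed.

Lemma In_fv_lam (V : Type) (x : V) a u :
  In x (fv (Lam a u)) <-> In x (fv a) \/ In (Some x) (fv u).
Proof. by rewrite /= List.in_app_iff In_pmap_id. Qed.

Lemma In_fv_app (V : Type) (x : V) u v :
  In x (fv (App u v)) <-> In x (fv u) \/ In x (fv v).
Proof. exact: List.in_app_iff. Qed.

(** Pointwise agreement avoids functional extensionality. Asking for it on free variables only is
    what later allows the choice of fresh names. *)
Lemma bind_ext (V W : Type) (f g : V -> term W) t :
  (forall x, In x (fv t) -> f x = g x) -> bind f t = bind g t.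
Proof.
elim: t W f g => {V} [V x|V|V a IHa u IHu|V u IHu v IHv] W f g fg //=.
- by apply: fg; left.
- congr Lam; first by apply: IHa => x xa; apply/fg/In_fv_lam; left.
  apply: IHu => -[x|] //= xu; congr rename; apply/fg/In_fv_lam; by right.
- by congr App; [apply: IHu|apply: IHv] => x xu;
    apply/fg/In_fv_app; [left|right].
Qed.

Lemma rename_bind_var (V W : Type) (f : V -> W) t :
  rename f t = bind (fun x => Var (f x)) t.
Proof.
elim: t W f => {V} [V x|V|V a IHa u IHu|V u IHu v IHv] W f //=.
- by rewrite IHa IHu; congr Lam; apply: bind_ext => -[].
- by rewrite IHu IHv.
Qed.

Lemma bind_rename (V W X : Type) (f : V -> W) (g : W -> term X) t :
  bind g (rename f t) = bind (fun x => g (f x)) t.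
Proof.
elim: t W X f g => {V} [V x|V|V a IHa u IHu|V u IHu v IHv] W X f g //=.
- by rewrite IHa IHu; congr Lam; apply: bind_ext => -[].
- by rewrite IHu IHv.
Qed.

Lemma rename_rename (V W X : Type) (f : V -> W) (g : W -> X) t :
  rename g (rename f t) = rename (fun x => g (f x)) t.
Proof. by rewrite rename_bind_var bind_rename -rename_bind_var. Qed.

Lemma rename_ext (V W : Type) (f g : V -> W) t :
  (forall x, In x (fv t) -> f x = g x) -> rename f t = rename g t.
Proof.
by move=> fg; rewrite !rename_bind_var; apply: bind_ext => x /fg->.
Qed.

Lemma rename_bind (V W X : Type) (f : V -> term W) (g : W -> X) t :
  rename g (bind f t) = bind (fun x => rename g (f x)) t.
Proof.
elim: t W X f g => {V} [V x|V|V a IHa u IHu|V u IHu v IHv] W X f g //=.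
- rewrite IHa IHu; congr Lam; apply: bind_ext => -[x|] //= _.
  by rewrite !rename_rename.
- by rewrite IHu IHv.
Qed.

Lemma bind_bind (V W X : Type) (f : V -> term W) (g : W -> term X) t :
  bind g (bind f t) = bind (fun x => bind g (f x)) t.
Proof.
elim: t W X f g => {V} [V x|V|V a IHa u IHu|V u IHu v IHv] W X f g //=.
- rewrite IHa IHu; congr Lam; apply: bind_ext => -[x|] //= _.
  by rewrite bind_rename rename_bind.
- by rewrite IHu IHv.
Qed.

Lemma bind_var (V : Type) (f : V -> term V) t :
  (forall x, In x (fv t) -> f x = Var x) -> bind f t = t.
Proof.
elim: t f => {V} [V x|V|V a IHa u IHu|V u IHu v IHv] f fV //=.
- by apply: fV; left.
- congr Lam; first by apply: IHa => x xa; apply/fV/In_fv_lam; left.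
  by apply: IHu => -[x|] //= xu; rewrite fV //; apply/In_fv_lam; right.
- by congr App; [apply: IHu|apply: IHv] => x xu;
    apply/fV/In_fv_app; [left|right].
Qed.

Lemma rename_id (V : Type) (f : V -> V) t :
  (forall x, In x (fv t) -> f x = x) -> rename f t = t.
Proof. by move=> fK; rewrite rename_bind_var; apply: bind_var => x /fK->. Qed.

Lemma In_fv_rename (V W : Type) (f : V -> W) t y :
  In y (fv (rename f t)) -> exists2 x, In x (fv t) & y = f x.
Proof.
elim: t W f y => {V} [V x|V|V a IHa u IHu|V u IHu v IHv] W f y //.
- by move=> /= [<-|//]; exists x => //; left.
- cbn [rename bind] => /In_fv_lam[/(IHa W f y)|/(IHu _ _ (Some y))] [x xu yE].
    by exists x => //; apply/In_fv_lam; left.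
  by case: x xu yE => [x|] //= xu [->]; exists x => //; apply/In_fv_lam; right.
- by cbn [rename bind] => /In_fv_app[/(IHu W f y)|/(IHv W f y)]
    [x xu ->]; exists x => //;
    apply/In_fv_app; [left|right].
Qed.

Lemma In_fv_bind (V W : Type) (f : V -> term W) t y :
  In y (fv (bind f t)) -> exists2 x, In x (fv t) & In y (fv (f x)).
Proof.
elim: t W f y => {V} [V x|V|V a IHa u IHu|V u IHu v IHv] W f y //.
- by exists x => //; left.
- cbn [rename bind] => /In_fv_lam[/(IHa W f y)|/(IHu _ _ (Some y))] [x xu yE].
    by exists x => //; apply/In_fv_lam; left.
  case: x xu yE => [x|] /= xu; last by case.
  move=> yf; have [z zf [->]] := In_fv_rename yf; exists x => //.
  by apply/In_fv_lam; right.
- by cbn [rename bind] => /In_fv_app[/(IHu W f y)|/(IHv W f y)]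
    [x xu yx]; exists x => //;
    apply/In_fv_app; [left|right].
Qed.

(** * Parallel reduction *)

(** Contraction at a nameless binder: [App (Lam t u) v] contracts to [bind (inst v) u]. *)
Definition inst (V : Type) (v : term V) (o : option V) : term V :=
  if o is Some y then Var y else v.

(* [eqred] on terms over any type of variables: no names are chosen for the
   binders, so a redex and its body can be inverted without renaming. *)
Inductive peq (V : Type) : term V -> term V -> Prop :=
| peq_var x : peq (Var x) (Var x)
| peq_top : peq Top Top
| peq_topapp u : peq (App Top u) Top
| peq_app u u' v v' : peq u u' -> peq v v' -> peq (App u v) (App u' v')
| peq_beta t u u' v v' :
    peq u u' -> peq v v' -> peq (App (Lam t u) v) (bind (inst v') u')
| peq_lam t t' u u' : peq t t' -> peq u u' -> peq (Lam t u) (Lam t' u').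

Lemma peq_refl (V : Type) (t : term V) : peq t t.
Proof.
elim: t => {V} *; [exact: peq_var|exact: peq_top|exact: peq_lam|exact: peq_app].
Qed.

Lemma peq_rename (V W : Type) (f : V -> W) t t' :
  peq t t' -> peq (rename f t) (rename f t').
Proof.
move=> r; elim: r W f => {V t t'} [V x|V|V u|V u u' v v' _ IHu _ IHv
  |V a u u' v v' _ IHu _ IHv|V a a' u u' _ IHa _ IHu] W f /=; try by constructor.
rewrite rename_bind.
have ->: bind (fun o => rename f (inst v' o)) u' =
         bind (inst (rename f v')) (rename (omap f) u').
  by rewrite bind_rename; apply: bind_ext => -[].
exact: peq_beta.
Qed.

Lemma peq_bind (V W : Type) (f g : V -> term W) t t' :
  (forall x, peq (f x) (g x)) -> peq t t' -> peq (bind f t) (bind g t').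
Proof.
move=> fg r; elim: r W f g fg => {V t t'} [V x|V|V u|V u u' v v' _ IHu _ IHv
  |V a u u' v v' _ IHu _ IHv|V a a' u u' _ IHa _ IHu] W f g fg //=.
- exact: peq_top.
- exact: peq_topapp.
- by apply: peq_app; auto.
(* The substitution lemma for the contractum: the weakening done by [lift_subst] is undone by
   [inst]. *)
- have ->: bind g (bind (inst v') u') =
           bind (inst (bind g v')) (bind (lift_subst g) u').
    rewrite !bind_bind; apply: bind_ext => -[x|] //= _.
    by rewrite bind_rename bind_var.
  apply: peq_beta; [apply: IHu => -[x|] /=|exact: IHv].
    exact: peq_rename.
  exact: peq_var.
- apply: peq_lam; [exact: IHa|apply: IHu => -[x|] /=].
    exact: peq_rename.
  exact: peq_var.
Qed.

Lemma In_fv_peq (V : Type) (t t' : term V) x :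
  peq t t' -> In x (fv t') -> In x (fv t).
Proof.
move=> r; elim: r x => {V t t'} [V y|V|V u|V u u' v v' _ IHu _ IHv
  |V a u u' v v' _ IHu _ IHv|V a a' u u' _ IHa _ IHu] x //.
- by case/In_fv_app => [/IHu|/IHv] ?; apply/In_fv_app; [left|right].
- move=> xb; have [[y|] yu] := In_fv_bind xb;
    last by move/IHv=> ?; apply/In_fv_app; right.
  case=> // <-; apply/In_fv_app; left; apply/In_fv_lam; right; exact: IHu.
- by case/In_fv_lam => [/IHa|/IHu] ?; apply/In_fv_lam; [left|right].
Qed.

Lemma peq_varE (V : Type) (x : V) w : peq (Var x) w -> w = Var x.
Proof. by move=> r; inversion r. Qed.

Lemma peq_topE (V : Type) (w : term V) : peq Top w -> w = Top.
Proof. by move=> r; inversion r. Qed.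

Lemma peq_lamE (V : Type) (a : term V) u w : peq (Lam a u) w ->
  exists a' u', [/\ w = Lam a' u', peq a a' & peq u u'].
Proof. by move=> r; inversion r; subst; exists t', u'. Qed.

Variant peq_app_spec (V : Type) (u v : term V) : term V -> Prop :=
| PeqTopApp of u = Top : peq_app_spec u v Top
| PeqApp u' v' of peq u u' & peq v v' : peq_app_spec u v (App u' v')
| PeqBeta a b b' v' of u = Lam a b & peq b b' & peq v v' :
    peq_app_spec u v (bind (inst v') b').

Lemma peq_appP (V : Type) (u v : term V) w :
  peq (App u v) w -> peq_app_spec u v w.
Proof.
by move=> r; inversion r; subst; [apply: PeqTopApp|apply: PeqApp|apply: PeqBeta].
Qed.

Lemma peq_inst (V : Type) (u u' : term (option V)) v v' :
  peq u u' -> peq v v' -> peq (bind (inst v) u) (bind (inst v') u').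
Proof.
by move=> uu' vv'; apply: peq_bind => // -[x|] //=; apply: peq_var.
Qed.

(** Induction on one reduction and inversion of the other. The overlaps to resolve are [App Top u]
    and a redex contracted on one side only; all other pairs are joined componentwise. *)
Lemma peq_diamond (V : Type) (t t1 t2 : term V) :
  peq t t1 -> peq t t2 -> exists2 w, peq t1 w & peq t2 w.
Proof.
move=> r; elim: r t2 => {V t t1} [V x|V|V u|V u u' v v' ru IHu rv IHv
  |V a u u' v v' ru IHu rv IHv|V a a' u u' ra IHa ru IHu] t2.
- by move=> r2; rewrite (peq_varE r2); exists (Var x); apply: peq_var.
- by move=> r2; rewrite (peq_topE r2); exists Top; apply: peq_top.
- move=> r2; case: {r2}(peq_appP r2) => // [_|u' v' r2 _].
    by exists Top; apply: peq_top.
  by rewrite (peq_topE r2); exists Top; [apply: peq_top|apply: peq_topapp].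
- move=> r2; case: {r2}(peq_appP r2) =>
    [uT|u2 v2 /IHu[w1 ? ?] /IHv[w2 ? ?]|a b b' v2 uE rb].
  + rewrite {u IHu}uT in ru; rewrite (peq_topE ru).
    by exists Top; [apply: peq_topapp|apply: peq_top].
  + by exists (App w1 w2); apply: peq_app.
  + case/IHv=> wv ? ?; subst u.
    have [a' [b1 [uE ra rb1]]] := peq_lamE ru; subst u'.
    (* The induction hypothesis concerns the whole abstraction, so the reduct [b'] of its body is
       wrapped again, with the annotation left as it is. *)
    have [w wl wr] := IHu (Lam a b') (peq_lam (peq_refl a) rb).
    have [aw [bw [wE _ r1]]] := peq_lamE wl; subst w.
    have [_ [_ [[<- <-] _ r2]]] := peq_lamE wr.
    by exists (bind (inst wv) bw); [apply: peq_beta|apply: peq_inst].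
- move=> r2; case: {r2}(peq_appP r2) => // [u2 v2|a2 b b' v2 [_ <-]].
    move=> ra; have [a' [b1 [-> _ /IHu[wb ? ?]]]] := peq_lamE ra.
    move=> /IHv[wv ? ?].
    by exists (bind (inst wv) wb); [apply: peq_inst|apply: peq_beta].
  move=> /IHu[wb ? ?] /IHv[wv ? ?].
  by exists (bind (inst wv) wb); apply: peq_inst.
- move=> r2; have [a2 [u2 [-> /IHa[wa ? ?] /IHu[wu ? ?]]]] := peq_lamE r2.
  by exists (Lam wa wu); apply: peq_lam.
Qed.

(** * Named binders *)

(** The renaming inside [lam]: [lam x t u] is convertible to [Lam t (rename (abs x) u)]. *)
Definition abs (x y : nat) : option nat := if y == x then None else Some y.

Lemma inst_abs x v u : bind (inst v) (rename (abs x) u) = subst x v u.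
Proof.
by rewrite bind_rename; apply: bind_ext => y _; rewrite /abs; case: eqP.
Qed.

Lemma absK x : cancel (abs x) (odflt x).
Proof. by move=> y; rewrite /abs; case: eqP. Qed.

Lemma rename_absK x u : rename (odflt x) (rename (abs x) u) = u.
Proof. by rewrite rename_rename rename_id // => y _; rewrite absK. Qed.

(** The bound name survives because reduction creates no free variables: [Some x] is not free in
    [rename (abs x) u], hence not in the reduct of this body, and there [abs x] undoes [odflt x]. *)
Lemma peq_lam_named x a u w : peq (lam x a u) w ->
  exists a' u', [/\ w = lam x a' u', peq a a' & peq u u'].
Proof.
case/peq_lamE=> a' [b [-> ra rb]]; exists a', (rename (odflt x) b); split=> //.
  congr Lam; rewrite rename_rename rename_id // => -[y|] yb.
    have [z _] := In_fv_rename (In_fv_peq rb yb).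
    by rewrite /abs /=; case: eqP => // zx [->]; case: eqP.
  by rewrite /= /abs eqxx.
by move/(peq_rename (odflt x)): rb; rewrite rename_absK.
Qed.

Lemma eqred_peq t t' : eqred t t' -> peq t t'.
Proof.
elim=> {t t'}; try by constructor.
- by move=> x t u u' v v' _ ru _ rv; rewrite -inst_abs; apply: peq_beta rv;
    apply: peq_rename.
- by move=> x t t' u u' _ rt _ ru; apply: peq_lam => //; apply: peq_rename.
Qed.

Definition close (V : Type) (f : V -> nat) (x : nat) (o : option V) : nat :=
  if o is Some y then f y else x.

Lemma fresh_close (V : Type) (f : V -> nat) (l : seq (option V)) :
  exists x, forall y, In (Some y) l -> f y < x.
Proof.
elim: l => [|o l [x IH]]; first by exists 0.
(* A strict upper bound of all names is fresh; the default [0] for the bound variable can only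
   enlarge it. *)
exists (maxn x (oapp f 0 o).+1) => y /= [->|/IH yx]; rewrite leq_max.
  by rewrite leqnn orbT.
by rewrite yx.
Qed.

Lemma lam_close (V : Type) (f : V -> nat) x a (u : term (option V)) :
  (forall y, In (Some y) (fv u) -> f y < x) ->
  Lam a (rename (omap f) u) = lam x a (rename (close f x) u).
Proof.
move=> fx; congr Lam; rewrite rename_rename.
apply: rename_ext => -[y|] /= yu; last by rewrite eqxx.
by move: (fx y yu); case: ltngtP.
Qed.

(** The naming [f] is general because the type of variables changes under a binder. At each binder a
    name [x] above all names in the body is chosen, and the induction continues with [close f x];
    the same [x] serves the reduct, which has no new free variables. *)
Lemma peq_eqred_rename (V : Type) (f : V -> nat) t t' :
  peq t t' -> eqred (rename f t) (rename f t').
Proof.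
move=> r; elim: r f => {V t t'} [V x|V|V u|V u u' v v' _ IHu _ IHv
  |V a u u' v v' ru IHu _ IHv|V a a' u u' _ IHa ru IHu] f /=; try by constructor.
- have [x fx] := fresh_close f (fv u).
  have fx' y : In (Some y) (fv u') -> f y < x by move/(In_fv_peq ru)/fx.
  rewrite (lam_close _ fx).
  have ->: rename f (bind (inst v') u') =
           subst x (rename f v') (rename (close f x) u').
    rewrite /subst rename_bind bind_rename; apply: bind_ext => -[y|] /= yu.
      by move: (fx' y yu); case: ltngtP.
    by rewrite eqxx.
  exact: eqred_beta.
- have [x fx] := fresh_close f (fv u).
  have fx' y : In (Some y) (fv u') -> f y < x by move/(In_fv_peq ru)/fx.
  by rewrite (lam_close _ fx) (lam_close _ fx'); apply: eqred_lam.
Qed.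

Lemma peq_eqred (t t' : tm) : peq t t' -> eqred t t'.
Proof. by move/(peq_eqred_rename id); rewrite !rename_id. Qed.

Lemma red_peq t t' : red t t' -> peq t t'.
Proof.
elim=> {t t'} [x t u v|x t u u' _ ru|x t t' u _ rt|u u' v _ ru|u v v' _ rv].
- by rewrite -inst_abs; apply: peq_beta; apply: peq_refl.
- by apply: peq_lam; [apply: peq_refl|apply: peq_rename].
- by apply: peq_lam => //; apply: peq_refl.
- by apply: peq_app => //; apply: peq_refl.
- by apply: peq_app => //; apply: peq_refl.
Qed.

(** * Free variables and substitution in named terms *)

Lemma fv_rename_In (V W : Type) (f : V -> W) t x :
  In x (fv t) -> In (f x) (fv (rename f t)).
Proof.
elim: t W f x => {V} [V y|V|V a IHa u IHu|V u IHu v IHv] W f x //.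
- by case=> [->|//]; left.
- cbn [rename] => /In_fv_lam[xa|xu]; apply/In_fv_lam; [left|right].
    exact: IHa.
  exact: (IHu _ (omap f)) xu.
- by cbn [rename] => /In_fv_app[xu|xv]; apply/In_fv_app;
    [left; exact: IHu|right; exact: IHv].
Qed.

Lemma sub_fv_lam (x : nat) a u l :
  {subset fv (lam x a u) <= l} <->
  {subset fv a <= l} /\ {subset fv u <= x :: l}.
Proof.
split=> [sl|[sa su] y].
  split=> y /In_mem yu; first by apply/sl/In_mem/In_fv_lam; left.
  rewrite inE; case: (eqVneq y x) => //= yx; apply/sl/In_mem/In_fv_lam; right.
  by have := fv_rename_In (abs x) yu; rewrite /abs (negPf yx).
move/In_mem/In_fv_lam => [/In_mem/sa//|yu].
have [z /In_mem/su] := In_fv_rename yu.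
by rewrite inE; case: eqP => //= _ zl [->].
Qed.

Lemma sub_fv_app (u v : tm) (l : seq nat) :
  {subset fv (App u v) <= l} <-> {subset fv u <= l} /\ {subset fv v <= l}.
Proof.
split=> [sl|[su sv] y]; last by rewrite mem_cat => /orP[/su|/sv].
by split=> y yu; apply: sl; rewrite mem_cat yu ?orbT.
Qed.

Lemma sub_fv_peq (t t' : tm) (l : seq nat) :
  peq t t' -> {subset fv t <= l} -> {subset fv t' <= l}.
Proof. by move=> r sl x /In_mem /(In_fv_peq r) /In_mem/sl. Qed.

Lemma sub_fv_subst x v u l :
  {subset fv u <= x :: l} -> {subset fv v <= l} ->
  {subset fv (subst x v u) <= l}.
Proof.
move=> su sv y /In_mem yb; have [z /In_mem/su] := In_fv_bind yb.
by rewrite inE; case: eqP => /= _; [move=> _ /In_mem/sv|move=> zl [<-|]].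
Qed.

Lemma subst_fresh x v u : x \notin fv u -> subst x v u = u.
Proof.
move=> xu; apply: bind_var => y /In_mem yu.
by case: eqP => // yx; rewrite -yx yu in xu.
Qed.

Lemma subst_lam x v y a u : y != x -> y \notin fv v ->
  subst x v (lam y a u) = lam y (subst x v a) (subst x v u).
Proof.
move=> yx yv; rewrite /subst /lam /=; congr Lam.
rewrite bind_rename rename_bind; apply: bind_ext => z _.
case: (eqVneq z y) => [->|zy] /=.
  by rewrite (negPf yx) /= eqxx.
case: eqP => _ /=; last by rewrite (negPf zy).
by apply: rename_ext => w /In_mem wv; case: eqP => // wy; rewrite -wy wv in yv.
Qed.

Lemma peq_subst x v v' u u' :
  peq v v' -> peq u u' -> peq (subst x v u) (subst x v' u').
Proof.
by move=> vv'; apply: peq_bind => y; case: eqP => // _; apply: peq_var.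
Qed.

(** * Prevalidity *)

Lemma prevalid_push_inv G a s :
  prevalid G (a :: s) -> prevalid G s /\ {subset fv a <= dom G}.
Proof. by move=> p; inversion p. Qed.

Lemma prevalid_annot_inv G x t : prevalid ((x, t) :: G) [::] ->
  [/\ prevalid G [::], x \notin dom G & {subset fv t <= dom G}].
Proof. by move=> p; inversion p. Qed.

Lemma prevalid_ctx G s : prevalid G s -> prevalid G [::].
Proof. by elim=> //; constructor. Qed.

Lemma prevalid_extend G x a s :
  prevalid G (a :: s) -> x \notin dom G -> prevalid ((x, a) :: G) s.
Proof.
move=> /prevalid_push_inv[ps ga] xG.
have pG : prevalid ((x, a) :: G) [::].
  by apply: prevalid_annot => //; apply: prevalid_ctx ps.
elim: s ps => // b s IH /prevalid_push_inv[/IH ps gb].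
by apply: prevalid_push => // y /gb; rewrite inE orbC => ->.
Qed.

Lemma annotated_In G x t : annotated G x t <-> In (x, t) G.
Proof.
split=> [[G1 [G2 ->]]|xG]; last first.
  by have [G1 [G2 ->]] := List.in_split _ _ xG; exists G1, G2.
by apply/List.in_app_iff; right; left.
Qed.

Lemma has_subtype_In G x t : has_subtype G x t -> In (x, t) G.
Proof. by case=> G1 [G2 [-> _]]; apply/annotated_In; exists G1, G2. Qed.

Lemma prevalid_uniq G : prevalid G [::] -> uniq (dom G).
Proof.
elim: G => // -[x t] G IH /prevalid_annot_inv[/IH uG xG _].
by rewrite /= xG.
Qed.

(** A prevalid context annotates each variable once, so any annotation is the last one. *)
Lemma In_has_subtype G x t :
  prevalid G [::] -> In (x, t) G -> has_subtype G x t.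
Proof.
move=> /prevalid_uniq uG /annotated_In[G1 [G2 GE]]; exists G1, G2; split=> //.
move: uG; rewrite GE /dom /unzip1 map_cat cat_uniq /= => /and3P[_ /norP[xG _] _].
exact: xG.
Qed.

Lemma In_dom G x (t : tm) : In (x, t) G -> x \in dom G.
Proof.
elim: G => //= -[y b] G IH [[-> _]|/IH xG]; rewrite inE ?eqxx //=.
by rewrite xG orbT.
Qed.

Lemma sub_fv_In G x t :
  prevalid G [::] -> In (x, t) G -> {subset fv t <= dom G}.
Proof.
elim: G => //= -[y b] G IH /prevalid_annot_inv[pG yG sb] inG z zt.
rewrite inE; case: inG => [[_ bE]|/(IH pG) st].
  by rewrite sb ?orbT // bE.
by rewrite st ?orbT.
Qed.

(** * Substitution of an annotated variable by its annotation *)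

(** Used on [G1 ++ G2] where [x] was annotated between the two parts. By prevalidity [x] is not free
    in the older part [G2], so only annotations in [G1] can change. *)
Definition subst_ctx (x : nat) (v : tm) (G : ctx) : ctx :=
  [seq (p.1, subst x v p.2) | p <- G].

Lemma dom_subst_ctx x v G : dom (subst_ctx x v G) = dom G.
Proof. by rewrite /dom /unzip1 /subst_ctx -map_comp; apply: eq_map. Qed.

Lemma subst_ctx_fresh x v G :
  prevalid G [::] -> x \notin dom G -> subst_ctx x v G = G.
Proof.
elim: G => //= -[y b] G IH /prevalid_annot_inv[pG yG sb].
rewrite inE => /norP[xy xG]; rewrite IH // subst_fresh //.
by apply: contra xG; apply: sb.
Qed.

Lemma dom_insert G1 G2 x (v : tm) :
  dom (G1 ++ (x, v) :: G2) =i x :: dom (G1 ++ G2).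
Proof.
move=> y; rewrite /dom /unzip1 !map_cat /= !(inE, mem_cat) /=.
by rewrite orbCA.
Qed.

Lemma prevalid_insert G1 G2 x v : prevalid (G1 ++ (x, v) :: G2) [::] ->
  [/\ prevalid G2 [::], x \notin dom (G1 ++ G2) & {subset fv v <= dom G2}].
Proof.
elim: G1 => [/prevalid_annot_inv//|[y b] G1 IH].
move=> /prevalid_annot_inv[/IH[p2 xG sv] yG sb]; split=> //=.
move: yG; rewrite dom_insert !inE => /norP[yx _].
by rewrite eq_sym (negPf yx).
Qed.

Lemma sub_dom_catr G1 G2 (l : seq nat) :
  {subset l <= dom G2} -> {subset l <= dom (G1 ++ G2)}.
Proof. by move=> sl y /sl; rewrite /dom /unzip1 map_cat mem_cat orbC => ->. Qed.

Lemma annotation_fresh G1 G2 x v :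
  prevalid (G1 ++ (x, v) :: G2) [::] -> x \notin fv v.
Proof.
move=> /prevalid_insert[_ xG /(sub_dom_catr G1) sv].
by apply: contra xG => /sv.
Qed.

Lemma prevalid_subst G1 G2 x v s : prevalid (G1 ++ (x, v) :: G2) s ->
  prevalid (subst_ctx x v (G1 ++ G2)) [seq subst x v a | a <- s].
Proof.
have sub_dom G a : {subset fv a <= dom (G ++ (x, v) :: G2)} ->
    {subset fv v <= dom G2} ->
    {subset fv (subst x v a) <= dom (subst_ctx x v (G ++ G2))}.
  rewrite dom_subst_ctx => sa sv; apply: sub_fv_subst => y.
    by move/sa; rewrite dom_insert.
  by move/sv; rewrite /dom /unzip1 map_cat mem_cat orbC => ->.
move=> p; have /prevalid_insert[p2 xG sv] := prevalid_ctx p.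
elim: s p => [|a s IH] /=.
  elim: G1 xG => [|[y b] G1 IH] /= xG.
    by rewrite subst_ctx_fresh.
  move=> /prevalid_annot_inv[pG yG sb].
  apply: prevalid_annot.
  - by apply: IH => //; move: xG; rewrite inE => /norP[].
  - by rewrite dom_subst_ctx; move: yG; rewrite dom_insert inE => /norP[].
  - exact: sub_dom.
move=> /prevalid_push_inv[/IH ps sa].
by apply: prevalid_push => //; apply: sub_dom.
Qed.

Lemma In_insert G1 G2 x v y t : prevalid (G1 ++ (x, v) :: G2) [::] ->
  In (y, t) (G1 ++ (x, v) :: G2) ->
  (y = x /\ t = v) \/ y != x /\ In (y, subst x v t) (subst_ctx x v (G1 ++ G2)).
Proof.
move=> /prevalid_insert[_ xG _] inG.
have [inG'|[-> ->]] : In (y, t) (G1 ++ G2) \/ (y, t) = (x, v).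
- move: inG; rewrite !List.in_app_iff /=.
  by case=> [?|[<-|?]]; [left; left|right|left; right].
- right; split; last by apply: (List.in_map (fun p => (p.1, subst x v p.2))) inG'.
  by apply: contraNneq xG => <-; apply: In_dom inG'.
- by left.
Qed.

Lemma subred_prevalid_ctx G s t u : subred G s t u -> prevalid G [::].
Proof.
elim=> {G s t u} //
  [G s x t /prevalid_ctx|G s u /prevalid_ctx|G s u v /prevalid_ctx
  |G s x a t u u' _ /prevalid_annot_inv[]|G x t u u' _ /prevalid_annot_inv[]] //.
Qed.

(** Supplies the side conditions of [subst_lam]: the premise of a binder rule annotates the bound
    name in a prevalid context, so this name cannot capture anything. *)
Lemma insert_fresh G1 G2 x v y a :
  prevalid ((y, a) :: G1 ++ (x, v) :: G2) [::] -> y != x /\ y \notin fv v.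
Proof.
move=> /prevalid_annot_inv[/prevalid_insert[_ _ sv] yG _].
move: yG; rewrite dom_insert inE => /norP[-> yG]; split=> //.
by apply: contra yG => /(sub_dom_catr G1 sv).
Qed.

Lemma subred_subst G s t u G1 G2 x v :
  subred G s t u -> G = G1 ++ (x, v) :: G2 ->
  subred (subst_ctx x v (G1 ++ G2)) [seq subst x v a | a <- s]
         (subst x v t) (subst x v u).
Proof.
move=> r; elim: r G1 => {G s t u}
  [G s y t p an|G s u p|G s u w p r|G s u u' w r IH|G s y a t u u' r IH
  |G y t u u' r IH] G1 GE; subst G.
- have ps := prevalid_subst p.
  have pG := prevalid_ctx p.
  move/annotated_In: an => /(In_insert pG)[[-> ->]|[yx inG]].
    (* The promotion of [x] becomes a reflexive step from [v], because [x] is not free in its own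
       annotation. *)
    rewrite {2}/subst /= eqxx subst_fresh.
      by apply: subred_eq => //; apply/peq_eqred/peq_refl.
    exact: annotation_fresh pG.
  rewrite {2}/subst /= (negPf yx).
  by apply: subred_prom => //; apply/annotated_In.
- by apply: subred_top; apply: prevalid_subst.
- apply: subred_eq; first exact: prevalid_subst.
  by apply/peq_eqred/peq_subst/eqred_peq => //; apply: peq_refl.
- by apply: subred_app; apply: IH.
- have [yx yv] := insert_fresh (subred_prevalid_ctx r).
  by rewrite !subst_lam //; apply: subred_funop; apply: (IH ((y, a) :: G1)).
- have [yx yv] := insert_fresh (subred_prevalid_ctx r).
  by rewrite !subst_lam //; apply: subred_fun; apply: (IH ((y, t) :: G1)).
Qed.

Lemma sub_subst G1 G2 s t u x v :
  sub (G1 ++ (x, v) :: G2) s t u ->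
  sub (subst_ctx x v (G1 ++ G2)) [seq subst x v a | a <- s]
      (subst x v t) (subst x v u).
Proof.
elim=> {t u} [t p|t t' u r _ IH|t u u' _ IH r].
- by apply: Defs.sub_refl; apply: prevalid_subst.
- by apply: sub_left IH; apply: subred_subst r _.
- apply: sub_right IH _; apply/peq_eqred/peq_subst/eqred_peq => //.
  exact: peq_refl.
Qed.

(* Well-formedness under substitution *)
Scheme wf_mut := Minimality for wf Sort Prop
  with wfsub_mut := Minimality for wfsub Sort Prop
  with wfsub_trans_mut := Minimality for wfsub_trans Sort Prop.
Combined Scheme wf_ind3 from wf_mut, wfsub_mut, wfsub_trans_mut.

Lemma wf_prevalid_ctx G s t : wf G s t -> prevalid G [::].
Proof.
pose P G (s : stack) (t : tm) := prevalid G [::].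
pose Q G (s : stack) (t u : tm) := prevalid G [::].
move: G s t; suff [] : (forall G s t, wf G s t -> P G s t) /\
  (forall G s t u, wfsub G s t u -> Q G s t u) /\
  (forall G s t u, wfsub_trans G s t u -> Q G s t u) by [].
by apply: wf_ind3 => // G s /prevalid_ctx.
Qed.

Lemma wf_subst G1 G2 s t x v : wf (G1 ++ (x, v) :: G2) s t ->
  wf (subst_ctx x v (G1 ++ G2)) [seq subst x v a | a <- s] (subst x v t).
Proof.
pose P G s t := forall G1, G = G1 ++ (x, v) :: G2 ->
  wf (subst_ctx x v (G1 ++ G2)) [seq subst x v a | a <- s] (subst x v t).
pose Q (R : ctx -> stack -> tm -> tm -> Prop) G s t u :=
  forall G1, G = G1 ++ (x, v) :: G2 ->
  R (subst_ctx x v (G1 ++ G2)) [seq subst x v a | a <- s]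
    (subst x v t) (subst x v u).
suff [h _] : (forall G s t, wf G s t -> P G s t) /\
  (forall G s t u, wfsub G s t u -> Q wfsub G s t u) /\
  (forall G s t u, wfsub_trans G s t u -> Q wfsub_trans G s t u).
  by move=> w; apply: h w _ _.
apply: wf_ind3 => {G1 s t} [G s y t p st wt IH|G s p|G y t u wu IHu _ IHt
  |G s y d t u wu IHu _ IHt|G s y t u w _ IHu _ IHw|G s u t _ IHu _ IHt su
  |G s u t _ IH|G s u t w _ IH1 _ IH2 _ IHw] G1 GE; subst G.
- have ps := prevalid_subst p.
  have pG := prevalid_ctx p.
  have [[yx tv]|[yx inG]] := In_insert pG (has_subtype_In st).
    (* The premise of [wf_var] says that the annotation [v] is well-formed under the same stack.
       Substitution fixes [v], so its induction hypothesis is the goal. *)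
    subst y t; have := IH _ erefl.
    rewrite [X in _ -> wf _ _ X]/subst /= eqxx subst_fresh //.
    exact: annotation_fresh pG.
  rewrite {2}/subst /= (negPf yx).
  apply: wf_var (IH _ erefl) => //; apply: In_has_subtype inG.
  exact: prevalid_ctx ps.
- by apply: wf_top; apply: prevalid_subst.
- have [yx yv] := insert_fresh (wf_prevalid_ctx wu).
  by rewrite subst_lam //; apply: wf_fun;
    [apply: (IHu ((y, t) :: G1))|apply: IHt].
- have [yx yv] := insert_fresh (wf_prevalid_ctx wu).
  by rewrite subst_lam //; apply: wf_funop;
    [apply: (IHu ((y, d) :: G1))|apply: IHt].
- exact: (wf_app (IHu _ erefl) (IHw _ erefl)).
- by apply: wfsub_rule; [apply: IHu|apply: IHt|apply: sub_subst].
- by apply: wfsub_trans_sub; apply: IH.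
- exact: (wfsub_trans_trans (IH1 _ erefl) (IH2 _ erefl) (IHw _ erefl)).
Qed.

(** * Reduction of contexts, stacks and terms *)

Definition peq_ctx : ctx -> ctx -> Prop :=
  List.Forall2 (fun p q => p.1 = q.1 /\ peq p.2 q.2).

Definition peq_stack : stack -> stack -> Prop := List.Forall2 (@peq nat).

Lemma peq_ctx_refl G : peq_ctx G G.
Proof.
by elim: G => [|p G IH]; constructor => //; split=> //; apply: peq_refl.
Qed.

Lemma peq_stack_refl s : peq_stack s s.
Proof. by elim: s => [|a s IH]; constructor => //; apply: peq_refl. Qed.

Lemma peq_ctx_cons x a a' G G' :
  peq a a' -> peq_ctx G G' -> peq_ctx ((x, a) :: G) ((x, a') :: G').
Proof. by constructor. Qed.

Lemma peq_stack_cons a a' s s' :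
  peq a a' -> peq_stack s s' -> peq_stack (a :: s) (a' :: s').
Proof. by constructor. Qed.

Lemma peq_stack_consE a s s' : peq_stack (a :: s) s' ->
  exists a' s'', [/\ s' = a' :: s'', peq a a' & peq_stack s s''].
Proof. by move=> r; inversion r; subst; exists y, l'. Qed.

Lemma peq_stack_nilE s : peq_stack [::] s -> s = [::].
Proof. by move=> r; inversion r. Qed.

Lemma peq_ctx_dom G G' : peq_ctx G G' -> dom G' = dom G.
Proof. by elim=> //= -[x a] [y b] {}G {}G' /= [<- _] _ ->. Qed.

Lemma peq_ctx_In G G' x t :
  peq_ctx G G' -> In (x, t) G -> exists2 t', peq t t' & In (x, t') G'.
Proof.
elim=> //= -[y a] [z b] {}G {}G' /= [<- ab] _ IH [[<- <-]|/IH[t' tt' inG]].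
  by exists b => //; left.
by exists t' => //; right.
Qed.

Lemma peq_prevalid G G' s s' :
  prevalid G s -> peq_ctx G G' -> peq_stack s s' -> prevalid G' s'.
Proof.
move=> p; elim: p G' s' => {G s} [|G x t _ IH xG tG|G a s _ IH aG] G' s' rG rs.
- by inversion rG; inversion rs; apply: prevalid_nil.
- rewrite (peq_stack_nilE rs).
  inversion rG as [|? [y t'] ? G'' [xy rt] rG']; subst.
  rewrite /= in xy rt; subst y.
  apply: prevalid_annot; first by apply: IH => //; apply: peq_stack_refl.
    by rewrite (peq_ctx_dom rG').
  by rewrite (peq_ctx_dom rG'); apply: sub_fv_peq tG.
- have [a' [s'' [-> ra rs']]] := peq_stack_consE rs.
  apply: prevalid_push; first exact: IH.
  by rewrite (peq_ctx_dom rG); apply: sub_fv_peq aG.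
Qed.

(** * Commutation of subtyping reduction with parallel reduction *)

Lemma sub_fv_subred G s t u :
  subred G s t u -> {subset fv t <= dom G} -> {subset fv u <= dom G}.
Proof.
elim=> {G s t u} //
  [G s x t p /annotated_In|G s u v _ /eqred_peq|G s u u' v _ IH
  |G s x a t u u' _ IH|G x t u u' _ IH].
- by move=> inG _; apply: sub_fv_In inG; apply: prevalid_ctx p.
- exact: sub_fv_peq.
- by move/sub_fv_app=> [/IH su sv]; apply/sub_fv_app.
- by move/sub_fv_lam=> [st /IH su]; apply/sub_fv_lam.
- by move/sub_fv_lam=> [st /IH su]; apply/sub_fv_lam.
Qed.

(** Prevalidity confines the variables of [G] and [s] to [dom G]. Hence contracting a redex whose
    bound name is fresh leaves its surroundings unchanged. *)
Lemma subst_top_fresh G s x v : prevalid G (v :: s) -> x \notin dom G ->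
  subst_ctx x v G = G /\ [seq subst x v a | a <- s] = s.
Proof.
move=> /prevalid_push_inv[p _] xG; split.
  by apply: subst_ctx_fresh => //; apply: prevalid_ctx p.
elim: s p => //= a s IH /prevalid_push_inv[/IH-> sa].
by rewrite subst_fresh //; apply: contra xG; apply: sa.
Qed.

(** By inversion the step is an equivalence reduction, which [peq_inst] instantiates, or a step in
    the body under [subred_funop]. There the bound variable is annotated with [v], not with [a], so
    [subred_subst] performs exactly the contraction. *)
Lemma subred_contract G s v a a' b b' : prevalid G (v :: s) ->
  subred G (v :: s) (Lam a b) (Lam a' b') ->
  subred G s (bind (inst v) b) (bind (inst v) b').
Proof.
move=> pv r; have [p _] := prevalid_push_inv pv.
inversion r as [| |? ? ? ? _ rE| |? ? x ? ? u u' ru|]; subst.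
  apply: subred_eq => //; apply/peq_eqred/peq_inst; last exact: peq_refl.
  by have [a1 [b1 [[_ ->] _]]] := peq_lamE (eqred_peq rE).
have [_ xG _] := prevalid_annot_inv (subred_prevalid_ctx ru).
have [GE sE] := subst_top_fresh pv xG.
by have := subred_subst (G1 := [::]) ru erefl; rewrite GE sE -!inst_abs.
Qed.

(** Prevalidity and the bound on free variables are carried along because a derivation does not give
    them back: in [subred_funop] the bound name may capture a variable of the stack. *)
Lemma subred_peq G s t u : subred G s t u ->
  forall G' s' t', prevalid G s -> {subset fv t <= dom G} ->
  peq_ctx G G' -> peq_stack s s' -> peq t t' ->
  exists2 u', subred G' s' t' u' & peq u u'.
Proof.
elim=> {G s t u} [G s x t _ an|G s u _|G s u v _ ruv|G s u u' v r IH
  |G s x a t u u' r IH|G x t u u' r IH] G' s' t' p sf rG rs rt;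
  have p' := peq_prevalid p rG rs.
- rewrite (peq_varE rt); move/annotated_In: an => /(peq_ctx_In rG)[w tw inG].
  by exists w => //; apply: subred_prom => //; apply/annotated_In.
- by exists Top; [apply: subred_top|apply: peq_top].
- have [w vw tw] := peq_diamond (eqred_peq ruv) rt.
  by exists w => //; apply: subred_eq => //; apply: peq_eqred.
- have [su sv] := (sub_fv_app _ _ _).1 sf.
  have pv : prevalid G (v :: s) by apply: prevalid_push.
  case: (peq_appP rt) => [uT|u1 v1 ru rv|b c c' v1 uE rc rv].
  + subst u; exists Top; first exact: subred_top.
    suff -> : u' = Top by apply: peq_topapp.
    by inversion r; subst => //; apply: peq_topE; apply: eqred_peq.
  + have [w rw u'w] := IH G' (v1 :: s') u1 pv su rG (peq_stack_cons rv rs) ru.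
    by exists (App w v1); [apply: subred_app|apply: peq_app].
  (* Here the redex is contracted while the subtyping step acts on its function. The function is
     first reduced without contraction, so that the induction hypothesis applies. *)
  + have rL : peq u (Lam b c').
      by rewrite uE; apply: peq_lam => //; apply: peq_refl.
    have [w rw u'w] := IH G' (v1 :: s') _ pv su rG (peq_stack_cons rv rs) rL.
    have pv' := peq_prevalid pv rG (peq_stack_cons rv rs).
    inversion r as [|? ? ? _|? ? ? ? _ ruu'| |? ? x ? a d d' _|];
      subst=> //.
    * by exists Top; [apply: subred_top|apply: peq_topapp].
    * have [z z1 z2] :=
        peq_diamond (peq_app (eqred_peq ruu') (peq_refl v)) (peq_beta b rc rv).
      by exists z => //; apply: subred_eq => //; apply: peq_eqred.
    (* The step was made in the body, so the common target [w] is again an abstraction and both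
       sides can be contracted. *)
    * have [b' [w0 [wE _ rw0]]] := peq_lamE u'w; subst w.
      by exists (bind (inst v1) w0);
        [apply: subred_contract rw|apply: peq_beta].
- have [a1 [s1 [s'E ra rs1]]] := peq_stack_consE rs; subst s'.
  have [t1 [u1 [-> rt1 ru1]]] := peq_lam_named rt.
  have [_ xG _] := prevalid_annot_inv (subred_prevalid_ctx r).
  have [_ su] := (sub_fv_lam _ _ _ _).1 sf.
  have [w rw u'w] := IH _ _ _ (prevalid_extend p xG) su
    (peq_ctx_cons x ra rG) rs1 ru1.
  exists (lam x t1 w); first exact: subred_funop.
  by apply: peq_lam => //; apply: peq_rename.
- have s'E := peq_stack_nilE rs; subst s'.
  have [t1 [u1 [-> rt1 ru1]]] := peq_lam_named rt.
  have [_ su] := (sub_fv_lam _ _ _ _).1 sf.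
  have [w rw u'w] := IH _ _ _ (subred_prevalid_ctx r) su
    (peq_ctx_cons x rt1 rG) (peq_stack_refl _) ru1.
  exists (lam x t1 w); first exact: subred_fun.
  by apply: peq_lam => //; apply: peq_rename.
Qed.

Lemma sub_prevalid G s t u : sub G s t u -> prevalid G s.
Proof. by elim. Qed.

(** Steps on the left are transported by [subred_peq]. On the right [sub_right] uses [eqred]
    backwards, so a common reduct given by the diamond property suffices. *)
Lemma sub_peq G s t u G' s' t' u' : sub G s t u ->
  {subset fv t <= dom G} -> peq_ctx G G' -> peq_stack s s' ->
  peq t t' -> peq u u' -> sub G' s' t' u'.
Proof.
move=> st sf rG rs; have p := sub_prevalid st; have p' := peq_prevalid p rG rs.
elim: st sf t' u' => {t u}
  [t _|t v u r _ IH|t u v _ IH /eqred_peq r] sf t' u' rt ru.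
- have [w tw uw] := peq_diamond rt ru.
  apply: (@sub_left _ _ _ w).
    by apply: subred_eq => //; apply: peq_eqred.
  by apply: sub_right (peq_eqred uw); apply: Defs.sub_refl.
- have [w rw vw] := subred_peq r p sf rG rs rt.
  by apply: sub_left rw _; apply: IH => //; apply: sub_fv_subred r sf.
- have [w uw vw] := peq_diamond r ru.
  by apply: sub_right (peq_eqred vw); apply: IH.
Qed.

(** * Preservation of well-formedness *)

Lemma wfsub_trans_prevalid G s t u : wfsub_trans G s t u -> prevalid G s.
Proof. by elim=> // {}G {}s v w [? ? ? ? _ _ /sub_prevalid]. Qed.

Lemma wfsub_trans_wf G s t u : wfsub_trans G s t u -> wf G s t.
Proof. by elim=> // {}G {}s v w []. Qed.

Lemma wf_sub_fv G s t : wf G s t -> {subset fv t <= dom G}.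
Proof.
pose P G (s : stack) t := {subset fv t <= dom G}.
pose Q G (s : stack) t (u : tm) := {subset fv t <= dom G}.
move: G s t; suff [] : (forall G s t, wf G s t -> P G s t) /\
  (forall G s t u, wfsub G s t u -> Q G s t u) /\
  (forall G s t u, wfsub_trans G s t u -> Q G s t u) by [].
apply: wf_ind3 => //
  [G s x t _ /has_subtype_In/In_dom xG _ _|G x t u _ IHu _ IHt
  |G s x d t u _ IHu _ IHt|G s x t u v _ IHu _ IHv].
- by move=> y; rewrite inE => /eqP->.
- exact/sub_fv_lam.
- exact/sub_fv_lam.
- exact/sub_fv_app.
Qed.

(** Since the stack is not empty, only [wf_funop] derives the hypothesis, and its premise annotates
    the bound variable with the argument [v]. Then [wf_subst] replaces a variable by its own
    annotation. *)
Lemma wf_contract G s v a b : prevalid G (v :: s) ->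
  wf G (v :: s) (Lam a b) -> wf G s (bind (inst v) b).
Proof.
move=> pv w; inversion w as [| | |? ? x ? ? u wu _|]; subst.
have [_ xG _] := prevalid_annot_inv (wf_prevalid_ctx wu).
have [GE sE] := subst_top_fresh pv xG.
by have := wf_subst (G1 := [::]) wu; rewrite GE sE -inst_abs.
Qed.

(* [wf G s t] alone does not give [prevalid G s]: in [wf_funop] the name of the
   bound variable may capture a variable of the stack. Subtyping does give it. *)
Lemma wf_peq G s t G' s' t' : wf G s t -> prevalid G s ->
  peq_ctx G G' -> peq_stack s s' -> peq t t' -> wf G' s' t'.
Proof.
pose P G s t := prevalid G s -> forall G' s' t',
  peq_ctx G G' -> peq_stack s s' -> peq t t' -> wf G' s' t'.
pose Q (R : ctx -> stack -> tm -> tm -> Prop) G s t u := forall G' s' t' u',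
  peq_ctx G G' -> peq_stack s s' -> peq t t' -> peq u u' -> R G' s' t' u'.
suff [h _] : (forall G s t, wf G s t -> P G s t) /\
  (forall G s t u, wfsub G s t u -> Q wfsub G s t u) /\
  (forall G s t u, wfsub_trans G s t u -> Q wfsub_trans G s t u).
  by move=> w p; apply: h w p _ _ _.
apply: wf_ind3 => {G s t G' s' t'}
  [G s x t p st wt IH _|G s p _|G x t u wu IHu wt IHt p
  |G s x d t u wu IHu wt IHt p|G s x t u v wu IHu wv IHv p|G s t u wt IHt wu IHu su
  |G s t u _ IH|G s t v u tv IH1 _ IH2 wv IHv].
- move=> G' s' t' rG rs rt; have p' := peq_prevalid p rG rs.
  rewrite (peq_varE rt); have [w tw inG] := peq_ctx_In rG (has_subtype_In st).
  apply: wf_var (IH p _ _ _ rG rs tw) => //.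
  by apply: In_has_subtype inG; apply: prevalid_ctx p'.
- move=> G' s' t' rG rs rt; rewrite (peq_topE rt).
  by apply: wf_top; apply: peq_prevalid p rG rs.
- move=> G' s' t' rG rs rt; have [t1 [u1 [-> rt1 ru1]]] := peq_lam_named rt.
  rewrite (peq_stack_nilE rs); apply: wf_fun.
    apply: IHu ru1; first exact: wf_prevalid_ctx wu.
      exact: peq_ctx_cons.
    exact: peq_stack_refl.
  exact: IHt rt1.
- move=> G' s' t' rG rs rt; have [t1 [u1 [-> rt1 ru1]]] := peq_lam_named rt.
  have [d1 [s1 [-> rd rs1]]] := peq_stack_consE rs.
  (* The premise on the body shows that [x] is fresh for [G]; that the stack does not mention [x]
     comes from [p]. *)
  have [_ xG _] := prevalid_annot_inv (wf_prevalid_ctx wu).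
  apply: wf_funop.
    by apply: IHu ru1 => //; [apply: prevalid_extend|apply: peq_ctx_cons].
  by apply: IHt rt1 => //; apply: prevalid_ctx p.
- move=> G' s' t' rG rs rt; have p' := peq_prevalid p rG rs.
  have rx := peq_refl (lam x t Top).
  case: (peq_appP rt) => [uT|u' v' ru rv|a b b' v' uE rb rv].
  + exact: wf_top.
  + apply: (@wf_app _ _ x t); last exact: IHv (peq_refl t).
    by apply: IHu => //; apply: peq_stack_cons.
  (* The abstraction is reduced without contraction against a stack that already holds the reduced
     argument [v'], so that [wf_contract] then substitutes [v']. *)
  + have rL : peq u (Lam a b').
      by rewrite uE; apply: peq_lam => //; apply: peq_refl.
    have w := IHu _ _ _ _ rG (peq_stack_cons rv rs) rL rx.
    exact: wf_contract (wfsub_trans_prevalid w) (wfsub_trans_wf w).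
- move=> G' s' t' u' rG rs rt ru; have p := sub_prevalid su.
  apply: wfsub_rule; [exact: IHt rt|exact: IHu ru|].
  exact: sub_peq su (wf_sub_fv wt) rG rs rt ru.
- by move=> G' s' t' u' rG rs rt ru; apply: wfsub_trans_sub; apply: IH.
- move=> G' s' t' u' rG rs rt ru; have p := wfsub_trans_prevalid tv.
  have rv := peq_refl v.
  (* The middle term of the chain stays [v] and is only transported to the reduced context and
     stack. *)
  apply: (@wfsub_trans_trans _ _ _ v); last exact: IHv rv.
    exact: IH1.
  exact: IH2.
Qed.

Theorem theorem4p2 (G : ctx) (s : stack) (t t' u : tm) :
  wfsub_trans G s t u -> red t t' -> wfsub_trans G s t' u.
Proof.
move=> tu /red_peq r; have p := wfsub_trans_prevalid tu.
have wt := wfsub_trans_wf tu.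
have wt' := wf_peq wt p (peq_ctx_refl G) (peq_stack_refl s) r.
apply: (wfsub_trans_trans _ tu wt); apply/wfsub_trans_sub/wfsub_rule => //.
exact: sub_right (Defs.sub_refl _ p) (peq_eqred r).
Qed.
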